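(* Let $1<p<\infty$ and let $\mathcal{A}=\mathcal{A}_u(B_{\ell_p})$. The fiber $\mathcal{M}_0$ in $\mathcal{M}(\mathcal{A}_u(B_{\ell_p}))$ over $0$ contains a set of cardinality $2^{\mathfrak{c}}$ such that any two distinct elements of this set belong to different Gleason parts.
   Context: Here $\ell_p$ is the complex Banach space of $p$-summable complex sequences, $B_{\ell_p}$ its open unit ball, and $\mathfrak{c}$ the cardinality of the continuum. $\mathcal{A}_u(B_{\ell_p})$ is the complex Banach algebra of all holomorphic functions $f\colon B_{\ell_p}\to\mathbb{C}$ that are uniformly continuous with respect to the norm of $\ell_p$, with the norm $\|f\|=\sup\{|f(x)|:\|x\|<1\}$. The spectrum $\mathcal{M}(\mathcal{A})$ of a commutative complex Banach algebra $\mathcal{A}$ with identity is the set of all nonzero algebra homomorphisms $\varphi\colon\mathcal{A}\to\mathbb{C}$. The (restrictions to $B_{\ell_p}$ of the) functionals of the dual space $\ell_p'$ belong to $\mathcal{A}_u(B_{\ell_p})$, and since $\ell_p$ is reflexive for $1<p<\infty$, each restriction $\varphi|_{\ell_p'}$, $\varphi\in\mathcal{M}(\mathcal{A}_u(B_{\ell_p}))$, is identified with a point of the closed unit ball $\overline{B}_{\ell_p}$. The fiber over $z\in\overline{B}_{\ell_p}$ is $\mathcal{M}_z=\{\varphi\in\mathcal{M}(\mathcal{A}_u(B_{\ell_p})):\varphi(x')=x'(z)\text{ for all }x'\in\ell_p'\}$. For $\varphi,\psi\in\mathcal{M}(\mathcal{A})$ put $\|\varphi-\psi\|=\sup\{|\varphi(f)-\psi(f)|: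 f\in\mathcal{A},\ \|f\|\le 1\}$. The relation $\|\varphi-\psi\|<2$ is an equivalence relation on $\mathcal{M}(\mathcal{A})$; its equivalence classes are the Gleason parts, and the Gleason part of $\varphi$ is $\mathcal{GP}(\varphi)=\{\psi\in\mathcal{M}(\mathcal{A}):\|\varphi-\psi\|<2\}$. *)

(* Defs.v *)
From HB Require Import structures.
From mathcomp Require Import all_boot all_order all_algebra.
From mathcomp Require Import all_classical all_reals all_analysis.
From mathcomp Require Import complex.

Set Implicit Arguments.
Unset Strict Implicit.
Unset Printing Implicit Defensive.

Import Order.TTheory GRing.Theory Num.Theory.
Import numFieldNormedType.Exports.
Import Normc.

Local Open Scope classical_set_scope.
Local Open Scope ring_scope.
Local Open Scope complex_scope.

Section psummable.
Context {R : realType}.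
Implicit Types (p : R) (x y : nat -> R[i]^o) (z w : R[i]).

Lemma normrE z : `|z| = (normc z)%:C.
Proof. by []. Qed.

Lemma normc_ge0 z : 0 <= normc z.
Proof. by case: z => a b; exact: sqrtr_ge0. Qed.

Lemma ler_normcD z w : normc (z + w) <= normc z + normc w.
Proof. exact: le_normcD. Qed.

Definition lp_sum p x : \bar R := (\sum_(n <oo) (normc (x n) `^ p)%:E)%E.

Definition lp_norm p x : R := fine (lp_sum p x) `^ p^-1.

Definition psummable p : {pred nat -> R[i]^o} := fun x => (lp_sum p x < +oo)%E.

Lemma lp_sum_ge0 p x : (0 <= lp_sum p x)%E.
Proof. by apply: nneseries_ge0 => n _ _; rewrite lee_fin powR_ge0. Qed.

Lemma lp_sum_fin p x : x \in psummable p -> (lp_sum p x \is a fin_num)%E.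
Proof. by move=> px; rewrite ge0_fin_numE ?lp_sum_ge0. Qed.

Lemma lp_sumZ p z x :
  (lp_sum p (z *: x) = (normc z `^ p)%:E * lp_sum p x)%E.
Proof.
rewrite -nneseriesZl //; last by move=> n _ ; rewrite lee_fin powR_ge0.
apply: eq_eseriesr => n _.
by rewrite [X in normc X]/(z * x n) normcM powRM ?normc_ge0 // EFinM.
Qed.

Lemma lp_minkowski p x y : 1 <= p ->
  ((lp_sum p (x + y)%R) `^ p^-1 <=
   (lp_sum p x) `^ p^-1 + (lp_sum p y) `^ p^-1)%E.
Proof.
move=> p1; have p0 : 0 < p by rewrite (lt_le_trans _ p1).
have mf (f : nat -> R) : measurable_fun setT f by [].
pose nx (u : nat -> R[i]^o) n := normc (u n).
have := minkowski_EFin counting (mf (nx x)) (mf (nx y)) p1.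
rewrite !Lnorm_counting // => mk.
have E u : (\sum_(k <oo) `|(nx u k)%:E| `^ p = lp_sum p u)%E.
  apply: eq_eseriesr => n _ /=.
  by rewrite ger0_norm ?normc_ge0 // poweR_EFin.
move: mk; rewrite !E; apply: le_trans.
apply: gt0_ler_poweR.
- by rewrite invr_ge0 ltW.
- by rewrite in_itv /= lp_sum_ge0 leey.
- rewrite in_itv /= leey andbT.
  by apply: nneseries_ge0 => n _ _ /=; first [exact: poweR_ge0 | rewrite lee_fin powR_ge0].
apply: lee_nneseries => n *; first by rewrite lee_fin powR_ge0.
rewrite /= lee_fin.
apply: ge0_ler_powR; rewrite ?nnegrE ?normc_ge0 ?(ltW p0) //.
rewrite ger0_norm ?addr_ge0 ?normc_ge0 //; exact: ler_normcD.
Qed.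
End psummable.

(* [p1] is a parameter so that the instances below can depend on it. *)
Record ellp (R : realType) (p : R) (p1 : 1 <= p) : Type := Ellp {
  ellp_seq :> nat -> R[i]^o ;
  _ : ellp_seq \in psummable p }.
Arguments ellp {R} p p1.

Section ellp.
Context {R : realType} (p : R) (p1 : 1 <= p).
Local Notation ellp := (ellp p p1).

HB.instance Definition _ := [isSub for @ellp_seq R p p1].
HB.instance Definition _ := [Choice of ellp by <:].

Lemma ellpP (x : ellp) : (x : nat -> R[i]^o) \in psummable p.
Proof. by case: x. Qed.

Let p_gt0 : 0 < p. Proof. exact: lt_le_trans p1. Qed.

Let poweRP (s : \bar R) : (0 <= s)%E -> (s `^ p^-1 < +oo)%E = (s < +oo)%E.
Proof.
move=> s0; apply/idP/idP; last by move=> ?; exact: poweR_lty.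
by apply: lty_poweRy; rewrite invr_eq0 gt_eqF.
Qed.

Lemma psummable_subsemimod : GRing.subsemimod_closed (psummable p).
Proof.
split; [split|].
- rewrite unfold_in /lp_sum eseries0 // => n _ _.
  by rewrite normc0 powR0 // gt_eqF.
- move=> x y; rewrite !unfold_in => xp yp.
  rewrite -poweRP ?lp_sum_ge0 //.
  by rewrite (le_lt_trans (lp_minkowski x y p1)) // lte_add_pinfty ?poweRP ?lp_sum_ge0.
- move=> z x; rewrite !unfold_in => xp.
  by rewrite lp_sumZ lte_mul_pinfty ?lee_fin ?powR_ge0.
Qed.

HB.instance Definition _ :=
  GRing.SubChoice_isSubLmodule.Build R[i] (nat -> R[i]^o) (psummable p) ellp
    psummable_subsemimod.

Definition ellp_norm (x : ellp) : R[i] := (lp_norm p x)%:C.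

Let fine_poweRD (a b c : \bar R) (r : R) :
  a \is a fin_num -> b \is a fin_num -> c \is a fin_num ->
  (c `^ r <= a `^ r + b `^ r)%E -> fine c `^ r <= fine a `^ r + fine b `^ r.
Proof.
by move=> /fineK <- /fineK <- /fineK <-; rewrite !poweR_EFin -EFinD lee_fin.
Qed.

Lemma ellp_normD (x y : ellp) : ellp_norm (x + y) <= ellp_norm x + ellp_norm y.
Proof.
have xyp : (x : nat -> R[i]^o) + y \in psummable p.
  by apply: (psummable_subsemimod.1.2); exact: ellpP.
have h : lp_norm p ((x : nat -> R[i]^o) + y) <= lp_norm p x + lp_norm p y.
  apply: fine_poweRD; [| | |exact: lp_minkowski].
  - exact/lp_sum_fin/ellpP.
  - exact/lp_sum_fin/ellpP.
  - exact: lp_sum_fin.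
by move: h; rewrite -lecR rmorphD.
Qed.

Lemma ellp_normZ (z : R[i]) (x : ellp) : ellp_norm (z *: x) = `|z| * ellp_norm x.
Proof.
rewrite /ellp_norm normrE.
suff -> : lp_norm p (z *: x) = normc z * lp_norm p x by rewrite rmorphM.
rewrite /lp_norm lp_sumZ fineM ?lp_sum_fin ?ellpP //.
rewrite /= powRM ?powR_ge0 ?fine_ge0 ?lp_sum_ge0 //.
by rewrite -powRrM divff ?gt_eqF // powRr1 // normc_ge0.
Qed.

Lemma ellp_norm0_eq0 (x : ellp) : ellp_norm x = 0 -> x = 0.
Proof.
move=> [] /eqP; rewrite powR_eq0 => /andP[/eqP x0 _].
apply/val_inj/funext => n.
have : lp_sum p x = 0%E.
  by rewrite -[LHS]fineK ?lp_sum_fin ?ellpP ?x0.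
move=> s0.
have : ((normc (x n) `^ p)%:E <= lp_sum p x)%E.
  apply: (@le_trans _ _ (\sum_(0 <= k < n.+1) (normc (x k) `^ p)%:E)%E).
    rewrite big_nat_recr //= leeDr // sume_ge0 // => k _.
    by rewrite lee_fin powR_ge0.
  by apply: nneseries_lim_ge => k _; rewrite lee_fin powR_ge0.
rewrite s0 lee_fin => h.
have /eqP : normc (x n) `^ p = 0 by apply/le_anti; rewrite h powR_ge0.
by rewrite powR_eq0 => /andP[/eqP /eq0_normc].
Qed.

HB.instance Definition _ := @Lmodule_isNormed.Build R[i] ellp
  ellp_norm ellp_normD ellp_normZ ellp_norm0_eq0.

End ellp.

(* The algebra of uniformly continuous holomorphic functions on the open unit
   ball of a complex normed space [V], with the sup norm. *)
Section Au.
Context {R : realType} (V : normedModType R[i]).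
Local Notation C := (R[i]^o).

Definition unit_ball : set V := [set x | `|x| < 1].

Lemma unit_ball0 : 0 \in unit_ball.
Proof. by rewrite inE /unit_ball /= normr0. Qed.

HB.instance Definition _ := isPointed.Build unit_ball (SigSub unit_ball0).

(* [g] only serves to make sense of differentiability at the points of the open
   ball; its values elsewhere are irrelevant. *)
Definition holomorphic (f : unit_ball -> C) : Prop :=
  exists2 g : V -> C, (forall x : unit_ball, g (val x) = f x)
    & forall x : V, unit_ball x -> differentiable g x.

Definition Au_pred : {pred unit_ball -> C} :=
  fun f => `[< holomorphic f /\ unif_continuous f >].

Record Au : Type := MkAu { Au_fun :> unit_ball -> C ; _ : Au_fun \in Au_pred }.

HB.instance Definition _ := [isSub for Au_fun].
HB.instance Definition _ := [Choice of Au by <:].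

Let gt0_complexP (d : R[i]) : 0 < d -> exists2 r : R, 0 < r & d = r%:C.
Proof.
move=> d0; have /complex_realP [r dr] := gtr0_real d0.
by exists r => //; rewrite -ltcR -dr.
Qed.

Lemma unif_continuous_ballP (f : unit_ball -> C) :
  unif_continuous f <->
  forall e : R, 0 < e -> exists2 d : R, 0 < d &
    forall x y : unit_ball, `|(val x : V) - val y| < d%:C ->
      normc (f x - f y) < e.
Proof.
split.
  move=> cf e e0.
  have e0' : 0 < e%:C by rewrite ltcR.
  have [B] := cf _ (entourage_ball C (PosNum e0')).
  rewrite -entourage_ballE => -[d /gt0_complexP [r r0 ->] dB] BU.
  exists r => // x y xyr.
  rewrite -ltcR.
  apply: (BU (x, y)); apply: dB => /=.
  by rewrite -ball_normE.
move=> H U; rewrite -entourage_ballE => -[d /gt0_complexP [r r0 ->] dU].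
have [s s0 sP] := H r r0.
exists [set xy | ball xy.1 s%:C xy.2].
  have s0' : 0 < s%:C by rewrite ltcR.
  exact: (entourage_ball V (PosNum s0')).
move=> [x y] /=; rewrite -ball_normE /= => /sP xy.
by apply: dU; rewrite /= -ball_normE /= -[ltLHS]normrE ltcR.
Qed.

Lemma unif_continuous_bounded (f : unit_ball -> C) : unif_continuous f ->
  exists M : R, forall x, normc (f x) <= M.
Proof.
move=> /unif_continuous_ballP/(_ 1 ltr01)[d d0 fd].
pose N := (Num.trunc d^-1).+1.
have N0 : 0 < N%:R :> R by rewrite ltr0n.
have Nd : N%:R^-1 < d.
  by rewrite invf_plt ?posrE // truncnS_gt // invr_ge0 ltW.
pose o : unit_ball := SigSub unit_ball0.
exists (normc (f o) + N%:R) => x.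
have x1 : `|val x : V| < 1 by have := set_valP x.
have ball_k k : (k <= N)%N -> ((k%:R / N%:R) *: (val x : V)) \in unit_ball.
  move=> kN; rewrite inE /unit_ball /= normrZ normf_div !normr_nat.
  apply: le_lt_trans x1; rewrite ler_piMl // ler_pdivrMr ?ltr0n // mul1r.
  by rewrite ler_nat.
suff H k (kN : (k <= N)%N) :
    normc (f (SigSub (ball_k k kN))) <= normc (f o) + k%:R.
  have := H N (leqnn N); congr (normc (f _) <= _); apply: val_inj => /=.
  by rewrite divff ?pnatr_eq0 // scale1r.
elim: k kN => [|k ih] kN.
  rewrite addr0 le_eqVlt; apply/orP; left; apply/eqP.
  by congr (normc (f _)); apply: val_inj; rewrite /= mul0r scale0r.
set u := f _; have := ih (ltnW kN); set v := f _ => vk.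
rewrite -[u](subrK v) (le_trans (ler_normcD _ _)) // addrC -natr1 addrA.
apply: lerD => //; apply/ltW/fd => /=.
rewrite -scalerBl -mulrBl -natrB // subSnn mul1r normrZ normfV normr_nat.
apply: (@le_lt_trans _ _ (N%:R^-1)).
  by rewrite ler_piMr ?invr_ge0 ?ler0n // ltW.
by rewrite -(rmorph_nat (real_complex R)) -fmorphV ltcR.
Qed.

Lemma Au_cst (z : R[i]) : cst z \in Au_pred.
Proof.
apply/asboolP; split.
  by exists (cst z) => // x _; exact: differentiable_cst.
apply/unif_continuous_ballP => e e0; exists 1 => // x y _.
by rewrite subrr normc0.
Qed.

Lemma Au_subring : GRing.subring_closed Au_pred.
Proof.
split.
- exact: (Au_cst 1).
- move=> f g /asboolP[[f' ff' df'] uf] /asboolP[[g' gg' dg'] ug].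
  apply/asboolP; split.
    exists (f' \- g') => [x|x xB]; first by rewrite /= ff' gg'.
    by apply: differentiableB; [exact: df'|exact: dg'].
  apply/unif_continuous_ballP => e e0; have e20 : 0 < e / 2 by rewrite divr_gt0.
  have /unif_continuous_ballP/(_ _ e20)[d1 d10 fd] := uf.
  have /unif_continuous_ballP/(_ _ e20)[d2 d20 gd] := ug.
  exists (Num.min d1 d2) => [|x y]; first by rewrite lt_min d10.
  move=> xyd.
  rewrite (_ : _ - _ = (f x - f y) + - (g x - g y)); last first.
    by rewrite -[(f - g) x]/(f x - g x) -[(f - g) y]/(f y - g y) !opprD !opprK addrACA.
  rewrite (le_lt_trans (ler_normcD _ _)) // [e]splitr normcN ltrD //.
    by apply: fd; rewrite (lt_le_trans xyd) // lecR ge_min lexx.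
  by apply: gd; rewrite (lt_le_trans xyd) // lecR ge_min lexx orbT.
- move=> f g /asboolP[[f' ff' df'] uf] /asboolP[[g' gg' dg'] ug].
  apply/asboolP; split.
    exists (f' * g') => [x|x xB]; first by rewrite -[LHS]/(f' _ * g' _) ff' gg'.
    by apply: differentiableM; [exact: df'|exact: dg'].
  have [M fM] := unif_continuous_bounded uf.
  have [M' gM'] := unif_continuous_bounded ug.
  pose K := `|M| + `|M'| + 1.
  have K0 : 0 < K by rewrite ltr_wpDl ?addr_ge0.
  have fK x : normc (f x) <= K.
    by rewrite (le_trans (fM x)) // (le_trans (ler_norm _)) // /K -addrA lerDl addr_ge0.
  have gK x : normc (g x) <= K.
    rewrite (le_trans (gM' x)) // (le_trans (ler_norm _)) // /K.
    by rewrite [`|M| + _]addrC -addrA lerDl addr_ge0.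
  apply/unif_continuous_ballP => e e0.
  have e20 : 0 < e / 2 / K by rewrite !divr_gt0.
  have /unif_continuous_ballP/(_ _ e20)[d1 d10 fd] := uf.
  have /unif_continuous_ballP/(_ _ e20)[d2 d20 gd] := ug.
  exists (Num.min d1 d2) => [|x y]; first by rewrite lt_min d10.
  move=> xyd.
  rewrite (_ : _ - _ = (f x - f y) * g x + f y * (g x - g y)); last first.
    by rewrite mulrBl mulrBr addrA subrK.
  rewrite (le_lt_trans (ler_normcD _ _)) // [e]splitr !normcM ltrD //.
    apply: (@le_lt_trans _ _ (normc (f x - f y) * K)).
      by rewrite ler_wpM2l ?normc_ge0.
    rewrite -ltr_pdivlMr //.
    by apply: fd; rewrite (lt_le_trans xyd) // lecR ge_min lexx.
  apply: (@le_lt_trans _ _ (K * normc (g x - g y))).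
    by rewrite ler_wpM2r ?normc_ge0.
  rewrite -ltr_pdivlMl // mulrC.
  by apply: gd; rewrite (lt_le_trans xyd) // lecR ge_min lexx orbT.
Qed.

Lemma Au_subsemimod : GRing.subsemimod_closed Au_pred.
Proof.
have [A1 AB AM] := Au_subring.
have A0 : 0 \in Au_pred by exact: (Au_cst 0).
split; [split => // f g Af Ag|move=> z f Af].
  by rewrite -[g]opprK AB // -sub0r AB.
exact: (AM _ _ (Au_cst z) Af).
Qed.

HB.instance Definition _ :=
  GRing.SubChoice_isSubComNzRing.Build (unit_ball -> C) Au_pred Au Au_subring.
HB.instance Definition _ :=
  GRing.SubZmodule_isSubLmodule.Build R[i] (unit_ball -> C) Au_pred Au Au_subsemimod.

Lemma Au_scalerAl (z : R[i]) (f g : Au) : z *: (f * g) = (z *: f) * g.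
Proof. by apply/val_inj/funext => x; exact: (mulrA z (f x) (g x)). Qed.

HB.instance Definition _ := GRing.Lmodule_isLalgebra.Build R[i] Au Au_scalerAl.
HB.instance Definition _ := GRing.Lalgebra_isComAlgebra.Build R[i] Au.

Definition Au_norm (f : Au) : R[i] :=
  (sup [set normc (f x) | x in [set: unit_ball]])%:C.

Let Au_has_sup (f : Au) : has_sup [set normc (f x) | x in [set: unit_ball]].
Proof.
split; first by exists (normc (f point)), point.
have /asboolP[_ /unif_continuous_bounded[M fM]] : val f \in Au_pred := valP f.
by exists M => _ [x _ <-].
Qed.

Lemma Au_norm_ub (f : Au) x : `|f x| <= Au_norm f.
Proof. by rewrite -[leLHS]normrE lecR; apply: sup_upper_bound => //; exists x. Qed.

Lemma Au_norm_le (f : Au) (M : R) :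
  (forall x, normc (f x) <= M) -> Au_norm f <= M%:C.
Proof.
move=> fM; rewrite lecR; apply: ge_sup; first by exists (normc (f point)), point.
by move=> _ [x _ <-].
Qed.

Lemma Au_normD (f g : Au) : Au_norm (f + g) <= Au_norm f + Au_norm g.
Proof.
rewrite {2 3}/Au_norm -rmorphD; apply: Au_norm_le => x.
rewrite (le_trans (ler_normcD (f x) (g x))) // lerD //.
  by rewrite -lecR; exact: Au_norm_ub.
by rewrite -lecR; exact: Au_norm_ub.
Qed.

Let Au_normZ_le (z : R[i]) (f : Au) : Au_norm (z *: f) <= `|z| * Au_norm f.
Proof.
rewrite {2}/Au_norm normrE -rmorphM; apply: Au_norm_le => x.
rewrite -[X in normc X]/(z * f x) normcM ler_wpM2l ?normc_ge0 //.
by rewrite -lecR; exact: Au_norm_ub.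
Qed.

Lemma Au_normZ (z : R[i]) (f : Au) : Au_norm (z *: f) = `|z| * Au_norm f.
Proof.
apply/le_anti; rewrite Au_normZ_le /=.
have [->|z0] := eqVneq z 0.
  by rewrite normr0 mul0r (le_trans _ (Au_norm_ub _ point)).
rewrite -ler_pdivlMl ?normr_gt0 // -normfV.
by rewrite -{1}[f](scalerK z0) Au_normZ_le.
Qed.

Lemma Au_norm0_eq0 (f : Au) : Au_norm f = 0 -> f = 0.
Proof.
move=> f0; apply/val_inj/funext => x; apply/eqP.
by rewrite -normr_le0 -f0; exact: Au_norm_ub.
Qed.

HB.instance Definition _ := @Lmodule_isNormed.Build R[i] Au
  Au_norm Au_normD Au_normZ Au_norm0_eq0.

Lemma linear_Au (l : {linear V -> C}) : continuous l ->
  (fun x : unit_ball => l (val x)) \in Au_pred.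
Proof.
move=> cl; apply/asboolP; split.
  exists (l : V -> C); first by [].
  move=> x _; exact: (@linear_differentiable _ V C l x cl).
have /linear_bounded_continuous/linear_boundedP/pinfty_ex_gt0[M M0 lM] := cl.
have [m m0 Mm] := gt0_complexP M0.
apply/unif_continuous_ballP => e e0; exists (e / m) => [|x y xyd].
  by rewrite divr_gt0.
rewrite -linearB -ltcR -normrE (le_lt_trans (lM _)) // Mm.
by rewrite -ltr_pdivlMl ?ltcR // mulrC -fmorphV -rmorphM.
Qed.

Definition restrict_dual (l : {linear V -> C}) (cl : continuous l) : Au :=
  MkAu (linear_Au cl).

Definition spectrum : set (Au -> C) :=
  [set phi | [/\ linear phi, {morph phi : f g / f * g} & phi <> cst 0]].

Definition fiber (z : V) : set (Au -> C) :=
  [set phi | spectrum phi /\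
    forall (l : {linear V -> C}) (cl : continuous l),
      phi (restrict_dual cl) = l z].

(* Extended-real valued: the sup is finite because characters are contractive,
   but the real-valued [sup] would be a junk value without that fact. *)
Definition char_dist (phi psi : Au -> C) : \bar R :=
  ereal_sup [set (normc (phi f - psi f))%:E | f in [set f : Au | `|f| <= 1]].

Definition gleason_part (phi : Au -> C) : set (Au -> C) :=
  [set psi | spectrum psi /\ (char_dist phi psi < 2%:E)%E].

End Au.

Arguments unit_ball {R} V.

(* Main.v *)
From HB Require Import structures.
Require Import Defs.
From mathcomp Require Import all_boot all_order all_algebra.
From mathcomp Require Import all_classical all_reals all_analysis.
From mathcomp Require Import complex ring.

Import Order.TTheory GRing.Theory Num.Theory.
Import numFieldNormedType.Exports.
Import Normc.

Local Open Scope classical_set_scope.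
Local Open Scope ring_scope.
Local Open Scope card_scope.
Local Open Scope complex_scope.

(** Let e_n be the unit vectors of l_p and x_n = (1 - 1/(n+1)) e_n, a sequence
    in the open unit ball.  For a free ultrafilter U on the naturals,
    phi_U(f) = lim_U f(x_n) is a character ([limit_char_spectrum]), because the
    limit of bounded sequences along an ultrafilter is linear and
    multiplicative.  It lies in the fiber over 0 ([limit_char_fiber]): since
    1 < p, the sequence e_n tends weakly to 0 ([basis_weakly_null]).

    Two such characters are as far apart as possible.  If B is in U and its
    complement is in V, take a natural exponent k >= p and
    P(x) = sum_n c_n x_n^k with c_n = 1 on B and c_n = -1 off B.  On the unit
    ball |P(x)| <= sum_n |x_n|^p <= 1, while P(x_n) = c_n (1 - 1/(n+1))^k, so
    that phi_U(P) = 1 and phi_V(P) = -1: a single polynomial of norm at most 1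
    gives ||phi_U - phi_V|| >= 2 ([char_dist_limit_char_ge2]), hence distinct
    Gleason parts.  That P is holomorphic and uniformly continuous follows from
    a second-order Taylor estimate that is uniform on the ball
    ([diag_poly_taylor]).

    It remains to find as many free ultrafilters as there are sets of reals.
    The naturals carry an independent family of subsets (A_r) indexed by the
    reals ([indep_set_independent]); a set X of reals yields a free ultrafilter
    containing A_r for r in X and the complement of A_r for r outside X
    ([indep_ultrafilters]), and distinct sets X, Y give ultrafilters that
    disagree on some A_r. *)

(** * Limits of bounded complex families along an ultrafilter *)

Lemma ultra_fmap {T U : Type} (f : T -> U) (F : set_system T) :
  UltraFilter F -> UltraFilter (f @ F).
Proof.
move=> FU; split=> [|G GP FG]; first exact: fmap_proper_filter.
rewrite eqEsubset; split => // A GA.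
have [//|FnA] := in_ultra_setVsetC (f @^-1` A) FU.
have [] : ~ G set0 by exact: filter_not_empty.
by rewrite -(setICr A); apply: filterI => //; apply: FG.
Qed.

Section NormC.
Context {R : rcfType}.
Implicit Types z : R[i].

Lemma sqr_normcE z : normc z ^+ 2 = complex.Re z ^+ 2 + complex.Im z ^+ 2.
Proof. by case: z => a b; rewrite sqr_sqrtr // addr_ge0 ?sqr_ge0. Qed.

Lemma ler_normc z (M : R) : 0 <= M ->
  (normc z <= M) = (complex.Re z ^+ 2 + complex.Im z ^+ 2 <= M ^+ 2).
Proof.
move=> M0; rewrite -sqr_normcE ler_sqr // ?nnegrE //.
by case: z => a b; exact: sqrtr_ge0.
Qed.

Lemma normRe_le z : `|complex.Re z| <= normc z.
Proof. by case: z => a b; rewrite -sqrtr_sqr ler_sqrt ?addr_ge0 ?sqr_ge0 ?lerDl ?sqr_ge0. Qed.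

Lemma normIm_le z : `|complex.Im z| <= normc z.
Proof. by case: z => a b; rewrite -sqrtr_sqr ler_sqrt ?addr_ge0 ?sqr_ge0 ?lerDr ?sqr_ge0. Qed.
End NormC.

Section GeneralizedLimit.
Context {R : realType} {T : Type} (F : set_system T) {FU : UltraFilter F}.
Local Notation C := (R[i]^o).
Implicit Types (a b : T -> C) (z : C).

Lemma ultra_cvg_bounded (u : T -> R) (M : R) :
  (forall t, `|u t| <= M) -> cvg (u @ F).
Proof.
move=> uM; have FuU := ultra_fmap u F FU.
have := @segment_compact R (- M) M.
rewrite compact_ultra => /(_ _ FuU)[].
  by apply: (@filterE _ F _) => t; rewrite /= in_itv /= -ler_norml; exact: uM.
by move=> l [_ ul]; apply/cvg_ex; exists l.
Qed.

Definition bounded_cfun a := exists M : R, forall t, normc (a t) <= M.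

(** Taken coordinatewise, so that the compactness of real segments gives the
    existence; the same operator serves below both to define characters and to
    sum series. *)
Definition glim a : C :=
  (lim ((fun t => complex.Re (a t)) @ F)) +i* (lim ((fun t => complex.Im (a t)) @ F)).

Lemma glim_cvg a : bounded_cfun a ->
  ((fun t => complex.Re (a t)) @ F --> complex.Re (glim a)) /\
  ((fun t => complex.Im (a t)) @ F --> complex.Im (glim a)).
Proof.
move=> [M aM]; split; apply: (ultra_cvg_bounded _ M) => t.
  exact: le_trans (normRe_le _) (aM t).
exact: le_trans (normIm_le _) (aM t).
Qed.

Lemma glim_unique a z :
  (fun t => complex.Re (a t)) @ F --> complex.Re z ->
  (fun t => complex.Im (a t)) @ F --> complex.Im z -> glim a = z.
Proof. by case: z => x y aRe aIm; congr Complex; apply: cvg_lim. Qed.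

Lemma glim_near a b : (\forall t \near F, a t = b t) -> glim a = glim b.
Proof.
move=> ab; have lim_near (u v : T -> R) : (\forall t \near F, u t = v t) ->
    lim (u @ F) = lim (v @ F).
  move=> uv; congr (lim _); rewrite eqEsubset; split; apply: near_eq_cvg => //.
  by apply: filterS uv.
by congr Complex; apply: lim_near; apply: filterS ab => t ->.
Qed.

Lemma glim_cst z : glim (fun=> z) = z.
Proof. by apply: glim_unique; exact: cvg_cst. Qed.

Lemma glimD a b : bounded_cfun a -> bounded_cfun b ->
  glim (fun t => a t + b t) = glim a + glim b.
Proof.
move=> /glim_cvg[aRe aIm] /glim_cvg[bRe bIm]; apply: glim_unique.
  rewrite raddfD; under eq_fun do rewrite raddfD; exact: cvgD.
rewrite raddfD; under eq_fun do rewrite raddfD; exact: cvgD.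
Qed.

Lemma glimM a b : bounded_cfun a -> bounded_cfun b ->
  glim (fun t => a t * b t) = glim a * glim b.
Proof.
have ReM (z w : C) : complex.Re (z * w) =
    complex.Re z * complex.Re w - complex.Im z * complex.Im w.
  by case: z w => ? ? [].
have ImM (z w : C) : complex.Im (z * w) =
    complex.Re z * complex.Im w + complex.Im z * complex.Re w.
  by case: z w => ? ? [].
move=> /glim_cvg[aRe aIm] /glim_cvg[bRe bIm]; apply: glim_unique.
  rewrite ReM; under eq_fun do rewrite ReM.
  by apply: cvgB; exact: cvgM.
rewrite ImM; under eq_fun do rewrite ImM.
by apply: cvgD; exact: cvgM.
Qed.

Lemma glimZ z b : bounded_cfun b -> glim (fun t => z * b t) = z * glim b.
Proof.
by move=> bb; rewrite glimM ?glim_cst //; exists (normc z) => t.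
Qed.

Lemma normc_glim_le a (M : R) : bounded_cfun a ->
  (\forall t \near F, normc (a t) <= M) -> normc (glim a) <= M.
Proof.
move=> /glim_cvg[aRe aIm] aM.
have M0 : 0 <= M.
  by have [t] := filter_ex aM; exact: le_trans (normc_ge0 _).
rewrite ler_normc //.
have cv : (fun t => complex.Re (a t) * complex.Re (a t) +
    complex.Im (a t) * complex.Im (a t)) @ F -->
    complex.Re (glim a) * complex.Re (glim a) +
    complex.Im (glim a) * complex.Im (glim a).
  exact: cvgD (cvgM aRe aRe) (cvgM aIm aIm).
rewrite !expr2 -(cvg_lim _ cv) //.
apply: limr_le; first by apply/cvg_ex; eexists; exact: cv.
by apply: filterS aM => t; rewrite ler_normc // !expr2.
Qed.

Lemma glim_eq a z : bounded_cfun a ->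
  (forall eps : R, 0 < eps -> \forall t \near F, normc (a t - z) <= eps) ->
  glim a = z.
Proof.
move=> ab az; have bz : bounded_cfun (fun _ : T => - z) by exists (normc (- z)).
have bd : bounded_cfun (fun t => a t - z).
  have [M aM] := ab; exists (M + normc (- z)) => t.
  by rewrite (le_trans (ler_normcD _ _)) // lerD2r.
suff : normc (glim a - z) <= 0.
  move=> h; apply/subr0_eq/eq0_normc/le_anti.
  by rewrite h normc_ge0.
rewrite -[- z]glim_cst -glimD //.
apply/ler_addgt0Pl => eps eps0; rewrite addr0.
by apply: normc_glim_le => //; exact: az.
Qed.

End GeneralizedLimit.

(** * A family of ultrafilters indexed by the sets of reals *)

Lemma injective_nat_unbounded (f : nat -> nat) (N : nat) :
  injective f -> exists k, (N <= f k)%N.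
Proof.
move=> fI; apply: contrapT => nfN.
have fN k : (f k < N)%N by rewrite ltnNge; apply/negP => Nf; apply: nfN; exists k.
pose g (k : 'I_N.+1) : 'I_N := Ordinal (fN k).
have gI : injective g by move=> i j /(congr1 val) /= /fI /val_inj.
by have := leq_card g gI; rewrite !card_ord ltnn.
Qed.

Section IndependentFamily.
Context {R : realType}.
Implicit Types (r : R) (I : rat * rat) (X : set R) (s : seq R).

Definition in_ratitv r I := ratr I.1 < r < ratr I.2.

(** A natural number codes a finite list of rational intervals, that is, a basic
    set of the line; the number belongs to the set attached to [r] when that
    basic set contains [r]. *)
Definition indep_set r : set nat :=
  [set n | if unpickle n is Some t then has (in_ratitv r) t else false].

Lemma ratitv_separate r s : r \notin s ->
  exists2 I, in_ratitv r I & forall q, q \in s -> ~~ in_ratitv q I.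
Proof.
have rat_between (x y : R) : x < y -> exists c : rat, x < ratr c < y.
  by move=> /rat_in_itvoo[c]; rewrite in_itv /=; exists c.
elim: s => [_|q s IHs].
  have [a /andP[_ ar]] := rat_between (r - 1) r ltac:(by rewrite gtrBl).
  have [b /andP[rb _]] := rat_between r (r + 1) ltac:(by rewrite ltrDl).
  by exists (a, b) => //; apply/andP.
rewrite in_cons negb_or => /andP[rq /IHs[[a b] /andP[/= ar rb] abs]].
have [qr|rltq|/eqP] := ltgtP q r; last by rewrite eq_sym (negbTE rq).
- have [c /andP[]] : exists c : rat, Num.max (ratr a) q < ratr c < r.
    by apply: rat_between; rewrite gt_max ar.
  rewrite gt_max => /andP[ac qc] cr.
  exists (c, b); first exact/andP.
  move=> t; rewrite in_cons => /predU1P[->|/abs].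
    by rewrite /in_ratitv /= ltNge (ltW qc).
  apply: contra => /andP[/= ct tb]; apply/andP; split=> //=.
  exact: lt_trans ct.
- have [c /andP[rc]] : exists c : rat, r < ratr c < Num.min (ratr b) q.
    by apply: rat_between; rewrite lt_min rb.
  rewrite lt_min => /andP[cb cq].
  exists (a, c); first exact/andP.
  move=> t; rewrite in_cons => /predU1P[->|/abs].
    by rewrite /in_ratitv /= andbC ltNge (ltW cq).
  apply: contra => /andP[/= at_ tc]; apply/andP; split=> //=.
  exact: lt_trans cb.
Qed.

(** Finitely many prescriptions [r \in X] or [r \notin X] are realized by a union
    of small rational intervals, one around each point that must be covered,
    avoiding the points that must not be. *)
Lemma indep_set_independent X s (N : nat) :
  exists2 n, (N <= n)%N & forall r, r \in s -> indep_set r n <-> X r.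
Proof.
pose out := [seq r <- s | ~~ `[< X r >]].
have /choice[J JP] : forall r, exists I, X r ->
    in_ratitv r I /\ forall q, q \in out -> ~~ in_ratitv q I.
  move=> r; have [Xr|] := pselect (X r); last by exists (0, 0).
  have [|I rI Iout] := ratitv_separate r out; last by exists I.
  by rewrite mem_filter; apply/negP => /andP[/asboolP].
(* The interval (0, 0) is empty: padding with copies of it changes the code
   but not the union, which makes the code arbitrarily large. *)
pose t k := nseq k (0 : rat, 0 : rat) ++ [seq J r | r <- s & `[< X r >]].
have tI : injective (fun k => pickle (t k)).
  move=> i j /(pcan_inj pickleK)/(congr1 size).
  by rewrite !size_cat !size_nseq => /addIn.
have [k Nk] := injective_nat_unbounded _ N tI.
exists (pickle (t k)) => // r rs; rewrite /indep_set /mkset pickleK has_cat.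
have -> : has (in_ratitv r) (nseq k (0 : rat, 0 : rat)) = false.
  rewrite has_nseq; apply/negP => /andP[_ /andP[r0 /(lt_trans r0)]].
  by rewrite ltxx.
split=> [/hasP[I]|Xr].
  move=> /mapP[q]; rewrite mem_filter => /andP[/asboolP Xq _] -> rJ.
  apply: contrapT => nXr; have [_ /(_ r)] := JP _ Xq.
  by rewrite rJ mem_filter rs andbT => /(_ (introN (asboolP _) nXr)).
apply/hasP; exists (J r); last by have [] := JP _ Xr.
by apply/mapP; exists r => //; rewrite mem_filter rs andbT; exact/asboolP.
Qed.

(** The filter generated by the tails, the sets attached to the points of [X] and
    the complements of those attached to the other points; properness is the
    independence of the family. *)
Definition indep_filter X : set_system nat :=
  [set B | exists s N, forall n, (N <= n)%N ->
    (forall r, r \in s -> indep_set r n <-> X r) -> B n].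

Lemma indep_filter_proper X : ProperFilter (indep_filter X).
Proof.
split; first by move=> [s [N sN]]; have [n Nn nX] := indep_set_independent X s N; exact: sN nX.
split; first by exists [::], 0%N.
  move=> A B [s [N sA]] [t [M tB]]; exists (s ++ t), (maxn N M) => n.
  rewrite geq_max => /andP[Nn Mn] stX; split; [apply: sA|apply: tB] => // r rs;
    by apply: stX; rewrite mem_cat rs ?orbT.
by move=> A B AB [s [N sA]]; exists s, N => n Nn /(sA n Nn)/AB.
Qed.

Lemma indep_ultrafilters : exists U : set R -> set_system nat,
  forall X, [/\ UltraFilter (U X),
    forall N, U X [set n | (N <= n)%N],
    forall r, X r -> U X (indep_set r) &
    forall r, ~ X r -> U X (~` indep_set r)].
Proof.
have /choice[U UP] : forall X, exists G, UltraFilter G /\ indep_filter X `<=` G.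
  by move=> X; have PF := indep_filter_proper X; exact: ultraFilterLemma.
exists U => X; have [UX sU] := UP X; split=> //.
- by move=> N; apply: sU; exists [::], N.
- move=> r Xr; apply: sU; exists [:: r], 0%N => n _ /(_ r).
  by rewrite mem_head => /(_ isT)[_]; exact.
- move=> r nXr; apply: sU; exists [:: r], 0%N => n _ /(_ r).
  by rewrite mem_head => /(_ isT)[rX _] /rX.
Qed.
End IndependentFamily.

(** * The second-order Taylor remainder of a complex power *)

Section Scalar.
Context {R : realType}.
Implicit Types (z w : R[i]) (t M : R).

Lemma normcX z m : normc (z ^+ m) = normc z ^+ m.
Proof. by elim: m => [|m IHm]; rewrite ?normc1 // !exprS normcM IHm. Qed.

Lemma normc_sum (a : nat -> R[i]) N :
  normc (\sum_(n < N) a n) <= \sum_(n < N) normc (a n).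
Proof.
elim: N => [|N IHN]; first by rewrite !big_ord0 normc0.
by rewrite !big_ord_recr /= (le_trans (ler_normcD _ _)) // lerD2r.
Qed.

Lemma normc_real t : normc t%:C = `|t|.
Proof. by rewrite /normc /= expr0n addr0 sqrtr_sqr. Qed.

Definition taylor_rem m z w :=
  (z + w) ^+ m.+1 - z ^+ m.+1 - (z ^+ m * w) *+ m.+1.

(** The remainder satisfies rem_(m+1) = (z + w) rem_m + (m+1) z^m w^2, so the
    bound follows by induction.  Measuring [w] relative to a common bound [M]
    of the two arguments leaves the homogeneous factor [M ^+ m.+1], which is what
    can be summed over the coordinates of a point of the unit ball. *)
Lemma taylor_rem_le m : exists2 K : R, 0 <= K & forall z w t M,
  0 <= t <= 1 -> normc z <= M -> normc w <= t * M ->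
  normc (taylor_rem m z w) <= K * t ^+ 2 * M ^+ m.+1.
Proof.
elim: m => [|m [K K0 IHm]].
  exists 0 => // z w t M _ _ _.
  have -> : taylor_rem 0 z w = 0 by rewrite /taylor_rem; ring.
  by rewrite normc0 !mul0r.
exists (2 * K + m.+1%:R) => [|z w t M t01 zM wM].
  by rewrite addr_ge0 ?mulr_ge0.
have M0 : 0 <= M by exact: le_trans (normc_ge0 z) zM.
have /andP[t0 t1] := t01.
have -> : taylor_rem m.+1 z w =
    (z + w) * taylor_rem m z w + (z ^+ m * w ^+ 2) *+ m.+1.
  by rewrite /taylor_rem [_ *+ m.+2]mulrSr !exprS; ring.
have zwM : normc (z + w) <= 2 * M.
  rewrite (le_trans (ler_normcD _ _)) // mulrDl !mul1r lerD //.
  by rewrite (le_trans wM) // ler_piMl.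
have h1 : normc ((z + w) * taylor_rem m z w) <= 2 * M * (K * t ^+ 2 * M ^+ m.+1).
  by rewrite normcM ler_pM ?normc_ge0 // IHm.
have h2 : normc ((z ^+ m * w ^+ 2) *+ m.+1) <= m.+1%:R * (M ^+ m * (t * M) ^+ 2).
  rewrite normcMn normcM !normcX -[leLHS]mulr_natl ler_wpM2l //.
  by rewrite ler_pM ?exprn_ge0 ?normc_ge0 // lerXn2r ?nnegrE ?mulr_ge0 ?normc_ge0.
rewrite (le_trans (ler_normcD _ _)) // (le_trans (lerD h1 h2)) //.
by rewrite le_eqVlt; apply/orP; left; apply/eqP; rewrite !exprS; ring.
Qed.
End Scalar.

(** * Coordinates and finitely supported elements of the sequence space *)

Section EllpBasics.
Context {R : realType} {p : R} {p1 : 1 <= p}.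
Local Notation C := (R[i]^o).
Local Notation E := (ellp p p1).
Implicit Types x y u : E.

Let p0 : 0 < p. Proof. exact: lt_le_trans p1. Qed.

Lemma ellp_normE x : `|x| = (lp_norm p x)%:C.
Proof. by []. Qed.

Lemma lp_norm_ge0 x : 0 <= lp_norm p x.
Proof. exact: powR_ge0. Qed.

Lemma ellpDE x y n : (x + y) n = x n + y n.
Proof. by []. Qed.

Lemma ellpZE (z : C) x n : (z *: x) n = z * x n.
Proof. by []. Qed.

Lemma lp_norm_powR x : (lp_norm p x `^ p)%:E = lp_sum p x.
Proof.
rewrite /lp_norm -powRrM mulVf ?gt_eqF // powRr1 ?fine_ge0 ?lp_sum_ge0 //.
by rewrite fineK // lp_sum_fin // ellpP.
Qed.

Lemma lp_partial_sum_le x N :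
  \sum_(n < N) normc (x n) `^ p <= lp_norm p x `^ p.
Proof.
rewrite -lee_fin lp_norm_powR -sumEFin.
rewrite -(big_mkord xpredT (fun n => (normc (x n) `^ p)%:E)).
by apply: nneseries_lim_ge => n _ _; rewrite lee_fin powR_ge0.
Qed.

Lemma normc_coord_le x n : normc (x n) <= lp_norm p x.
Proof.
have := lp_partial_sum_le x n.+1; rewrite big_ord_recr /= => h.
have {h} : normc (x n) `^ p <= lp_norm p x `^ p.
  by apply: le_trans h; rewrite lerDr sumr_ge0 // => k _; exact: powR_ge0.
apply: contraTT; rewrite -!ltNge => h.
by apply: gt0_ltr_powR => //; rewrite nnegrE ?lp_norm_ge0 ?normc_ge0.
Qed.

(** Polar decomposition, arranged so that the zero vector is no exception. *)
Lemma ellp_dilation x : exists2 u : E, lp_norm p u <= 1 &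
  x = (lp_norm p x)%:C *: u.
Proof.
have [x0|x0] := eqVneq (lp_norm p x) 0.
  exists 0; last first.
    by rewrite scaler0; apply/eqP; rewrite -normr_eq0 ellp_normE x0.
  by rewrite -lecR -ellp_normE normr0.
exists ((lp_norm p x)^-1%:C *: x); last first.
  by rewrite scalerA -rmorphM divff // scale1r.
rewrite -lecR -ellp_normE normrZ ellp_normE Defs.normrE -rmorphM normc_real ger0_norm.
  by rewrite mulVf.
by rewrite invr_ge0 lp_norm_ge0.
Qed.

Lemma lp_normZ (z : C) x : lp_norm p (z *: x) = normc z * lp_norm p x.
Proof.
have := ellp_normZ z x.
by rewrite /ellp_norm Defs.normrE -rmorphM => -[].
Qed.

(** In the unit ball the coordinates have modulus at most 1, and raising them to
    an exponent larger than [p] only makes them smaller. *)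
Lemma power_sum_le1 x m N : p <= m%:R -> lp_norm p x <= 1 ->
  \sum_(n < N) normc (x n) ^+ m <= 1.
Proof.
move=> pm x1; apply: (@le_trans _ _ (lp_norm p x `^ p)); last first.
  rewrite [leRHS](_ : 1 = 1 `^ p); last by rewrite powR1.
  by apply: ge0_ler_powR; rewrite ?nnegrE ?lp_norm_ge0 // ltW.
apply: le_trans (lp_partial_sum_le x N); apply: ler_sum => n _.
have [->|xn0] := eqVneq (normc (x n)) 0.
  rewrite expr0n powR0 ?gt_eqF //; case: m pm {x1} => //.
  by rewrite leNgt p0.
rewrite -powR_mulrn ?normc_ge0 //; apply: ger_powR => //.
rewrite lt_neqAle eq_sym xn0 normc_ge0 /=.
exact: le_trans (normc_coord_le _ _) x1.
Qed.

End EllpBasics.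

Section Basis.
Context {R : realType} {p : R} {p1 : 1 <= p}.
Local Notation C := (R[i]^o).
Local Notation E := (ellp p p1).

Let p0 : 0 < p. Proof. exact: lt_le_trans p1. Qed.

Lemma lp_sum_finite_support (x : nat -> C) N : (forall n, (N <= n)%N -> x n = 0) ->
  lp_sum p x = (\sum_(n < N) normc (x n) `^ p)%:E.
Proof.
move=> x0; rewrite /lp_sum.
rewrite (@nneseries_split _ _ 0 N); last by move=> n _; rewrite lee_fin powR_ge0.
rewrite add0n [X in (_ + X)%E]eseries0 => [|n Nn _]; last first.
  by rewrite x0 // normc0 powR0 // gt_eqF.
by rewrite adde0 big_mkord sumEFin.
Qed.

Lemma basis_psummable n : (fun k => (k == n)%:R : C) \in psummable p.
Proof.
rewrite unfold_in (@lp_sum_finite_support _ n.+1) ?ltry // => k nk.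
by rewrite gtn_eqF.
Qed.

Definition basis n : E := Ellp p1 (basis_psummable n).

Lemma basisE n k : basis n k = (k == n)%:R.
Proof. by []. Qed.

Lemma lp_norm_basis n : lp_norm p (basis n) = 1.
Proof.
rewrite /lp_norm (@lp_sum_finite_support _ n.+1) => [|k nk]; last by rewrite basisE gtn_eqF.
rewrite big_ord_recr /= big1 => [|k _]; last first.
  by rewrite ltn_eqF // normc0 powR0 // gt_eqF.
by rewrite eqxx normc1 add0r !powR1.
Qed.

Lemma basis_combE (c : nat -> C) N k :
  (\sum_(n < N) c n *: basis n : E) k = if (k < N)%N then c k else 0.
Proof.
elim: N => [|N IHN]; first by rewrite big_ord0.
rewrite big_ord_recr ellpDE ellpZE basisE IHN ltnS [(k <= N)%N]leq_eqVlt.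
by case: eqVneq => [->|_] /=; rewrite ?ltnn ?mulr1n ?mulr0n ?add0r ?mulr1 ?mulr0 ?addr0.
Qed.
End Basis.

(** * The unit vectors are weakly null *)

Section WeakNull.
Context {R : realType} {p : R} {p1 : 1 <= p} (p_gt1 : 1 < p).
Local Notation C := (R[i]^o).
Local Notation E := (ellp p p1).
Context (l : {linear E -> C}).
Local Notation e := (@basis R p p1).

Let p0 : 0 < p. Proof. exact: lt_le_trans p1. Qed.
Let q := p / (p - 1).
Let q0 : 0 < q. Proof. by rewrite divr_gt0 ?subr_gt0. Qed.

(** The easy half of the duality between l_p and l_q, where q = p / (p - 1): the
    functional is tested on the finitely supported vector at which the Hoelder
    inequality is an equality. *)
Lemma functional_coords_conj_sum (M : R) N : 0 <= M ->
  (forall h : E, normc (l h) <= M * lp_norm p h) ->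
  \sum_(n < N) normc (l (e n)) `^ q <= M `^ q.
Proof.
move=> M0 lM; set b := fun n => normc (l (e n)); set S := \sum_(n < N) _.
have b_ge0 n : 0 <= b n by exact: normc_ge0.
have S0 : 0 <= S by apply: sumr_ge0 => n _; exact: powR_ge0.
(* Where [l (e n) = 0] the quotient is 0, as division by 0 returns 0. *)
pose c n : C := (b n `^ q)%:C / l (e n).
have cl n : c n * l (e n) = (b n `^ q)%:C.
  have [l0|l0] := eqVneq (l (e n)) 0; last by rewrite /c divfK.
  by rewrite l0 mulr0 /b l0 normc0 powR0 // gt_eqF.
have cp n : normc (c n) `^ p = b n `^ q.
  have [b0|b0] := eqVneq (b n) 0.
    by rewrite /c b0 powR0 ?gt_eqF // mul0r normc0 powR0 // gt_eqF.
  rewrite /c normcM normcV normc_real ger0_norm ?powR_ge0 //.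
  rewrite -/(b n) -powR_inv1 ?b_ge0 // -powRD; last first.
    by rewrite b0 implybT.
  rewrite -powRrM; congr (_ `^ _).
  by rewrite /q; field; rewrite subr_eq0 gt_eqF.
pose x : E := \sum_(n < N) c n *: e n.
have lx : l x = S%:C.
  rewrite linear_sum /S rmorph_sum; apply: eq_bigr => n _.
  by rewrite linearZ; exact: cl.
have nx : lp_norm p x = S `^ p^-1.
  rewrite /lp_norm (@lp_sum_finite_support _ _ p1 _ N) => [|n Nn]; last first.
    by rewrite basis_combE ltnNge Nn.
  congr (_ `^ _); apply: eq_bigr => n _.
  by rewrite basis_combE ltn_ord cp.
have := lM x; rewrite lx nx normc_real ger0_norm //.
have [->|Sn0] := eqVneq S 0; first by rewrite powR_ge0.
(* From S <= M S^(1/p) one gets S^(1/q) <= M, as 1 - 1/p = 1/q. *)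
rewrite -ler_pdivrMr ?powR_gt0 ?lt_neqAle ?S0 ?andbT 1?eq_sym //.
rewrite -[X in X / _](powRr1 S0) -powRN -powRD ?Sn0 ?implybT // => SM.
rewrite -(powRr1 S0) (_ : 1 = (1 - p^-1) * q); last first.
  by rewrite /q; field; rewrite subr_eq0 !gt_eqF.
by rewrite powRrM; apply: ge0_ler_powR; rewrite ?nnegrE ?powR_ge0 // ltW.
Qed.

(** By [functional_coords_conj_sum] the values at the unit vectors are
    q-summable, so they tend to 0. *)
Lemma basis_weakly_null : continuous l -> forall eps : R, 0 < eps ->
  exists N, forall n, (N <= n)%N -> normc (l (e n)) <= eps.
Proof.
move=> /linear_bounded_continuous/linear_boundedP/pinfty_ex_gt0[M M0 lM] eps eps0.
have MR := RRe_real (gtr0_real M0); set m := complex.Re M in MR.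
have m0 : 0 < m by rewrite -ltcR MR.
have lm (h : E) : normc (l h) <= m * lp_norm p h.
  by have := lM h; rewrite -MR Defs.normrE ellp_normE -rmorphM lecR.
have cv : cvgn (series (fun n => normc (l (e n)) `^ q)).
  apply: nondecreasing_is_cvgn.
    apply/nondecreasing_seqP => n; rewrite /series /= big_nat_recr //= lerDl.
    exact: powR_ge0.
  exists (m `^ q) => _ [N _ <-]; rewrite /series /= big_mkord.
  by apply: functional_coords_conj_sum => //; exact: ltW.
have eq0 : 0 < eps `^ q by exact: powR_gt0.
have [N _ HN] := cvgr_lt _ (cvg_series_cvg_0 cv) _ eq0.
exists N => n Nn; have := HN n Nn; apply: contraTT; rewrite -leNgt -ltNge => h.
by apply: ge0_ler_powR; rewrite ?nnegrE ?normc_ge0 ?ltW.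
Qed.
End WeakNull.

(** * Diagonal polynomials *)

Section Polynomial.
Context {R : realType} {p : R} {p1 : 1 <= p}.
Local Notation C := (R[i]^o).
Local Notation E := (ellp p p1).
Context (F : set_system nat) {FU : UltraFilter F}.
Context (m : nat) (pm : p <= m.+1%:R) (c : nat -> C) (c1 : forall n, normc (c n) <= 1).
Implicit Types x h u : E.

(** The exponent is [m.+1], so that the differential involves the exponent [m]
    without truncated subtraction. *)
Definition diag_psum x N : C := \sum_(n < N) c n * x n ^+ m.+1.
Definition diff_psum x h N : C := \sum_(n < N) c n * ((x n ^+ m * h n) *+ m.+1).
Definition rem_psum x h N : C := \sum_(n < N) c n * taylor_rem m (x n) (h n).

Lemma diag_psum_add x h N : diag_psum (x + h) N = diag_psum x N + diff_psum x h N + rem_psum x h N.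
Proof.
rewrite /diag_psum /diff_psum /rem_psum -!big_split; apply: eq_bigr => n _.
by rewrite ellpDE /= -!mulrDr /taylor_rem; congr (_ * _); ring.
Qed.

Let coef_sum_le (a : nat -> C) N :
  normc (\sum_(n < N) c n * a n) <= \sum_(n < N) normc (a n).
Proof.
apply: le_trans (normc_sum (fun n => c n * a n) N) _; apply: ler_sum => n _.
by rewrite normcM ler_piMl ?normc_ge0.
Qed.

(** This replaces the Hoelder inequality: a product of coordinates of two
    vectors of the unit ball is dominated by a power of the larger one. *)
Let maxsum_le2 x u N : lp_norm p x <= 1 -> lp_norm p u <= 1 ->
  \sum_(n < N) Num.max (normc (x n)) (normc (u n)) ^+ m.+1 <= 2.
Proof.
move=> x1 u1; have := lerD (power_sum_le1 x m.+1 N pm x1) (power_sum_le1 u m.+1 N pm u1).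
rewrite -big_split /=; apply: le_trans; apply: ler_sum => n _.
by case: (leP (normc (x n)) (normc (u n))) => _; rewrite ?lerDl ?lerDr exprn_ge0 ?normc_ge0.
Qed.

Lemma diag_psum_le1 x N : lp_norm p x <= 1 -> normc (diag_psum x N) <= 1.
Proof.
move=> x1; apply: (le_trans (coef_sum_le (fun n => x n ^+ m.+1) N)).
apply: le_trans (power_sum_le1 x m.+1 N pm x1).
by apply: ler_sum => n _; rewrite normcX.
Qed.

Lemma diff_psum_le x h N : lp_norm p x <= 1 ->
  normc (diff_psum x h N) <= 2 * m.+1%:R * lp_norm p h.
Proof.
move=> x1; have [u u1 hu] := ellp_dilation h.
set t := lp_norm p h in hu *; have t0 : 0 <= t by exact: lp_norm_ge0.
apply: (le_trans (coef_sum_le (fun n => (x n ^+ m * h n) *+ m.+1) N)).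
apply: (@le_trans _ _ (\sum_(n < N) (m.+1%:R * t) *
    Num.max (normc (x n)) (normc (u n)) ^+ m.+1)); last first.
  rewrite -mulr_sumr -[leRHS]mulrA [leRHS]mulrC ler_wpM2l ?maxsum_le2 //.
  by rewrite mulr_ge0.
apply: ler_sum => n _; set M := Num.max _ _.
have xM : normc (x n) <= M by rewrite le_max lexx.
have uM : normc (u n) <= M by rewrite le_max lexx orbT.
have -> : h n = t%:C * u n by rewrite hu ellpZE.
rewrite normcMn -[leLHS]mulr_natl -mulrA ler_wpM2l //.
rewrite !normcM normcX normc_real ger0_norm // exprSr mulrCA ler_wpM2l //.
by rewrite ler_pM ?exprn_ge0 ?normc_ge0 // lerXn2r ?nnegrE ?normc_ge0 // (le_trans _ xM) ?normc_ge0.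
Qed.

Lemma rem_psum_le : exists2 K : R, 0 <= K & forall x h N,
  lp_norm p x <= 1 -> lp_norm p h <= 1 ->
  normc (rem_psum x h N) <= K * lp_norm p h ^+ 2.
Proof.
have [K K0 KP] := taylor_rem_le (R := R) m.
exists (2 * K) => [|x h N x1 h1]; first exact: mulr_ge0.
have [u u1 hu] := ellp_dilation h.
set t := lp_norm p h in hu h1 *; have t0 : 0 <= t by exact: lp_norm_ge0.
apply: (le_trans (coef_sum_le (fun n => taylor_rem m (x n) (h n)) N)).
apply: (@le_trans _ _ (\sum_(n < N) (K * t ^+ 2) *
    Num.max (normc (x n)) (normc (u n)) ^+ m.+1)); last first.
  rewrite -mulr_sumr -[leRHS]mulrA [leRHS]mulrC ler_wpM2l ?maxsum_le2 //.
  by rewrite mulr_ge0 ?exprn_ge0.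
apply: ler_sum => n _; apply: KP; first by rewrite t0.
  by rewrite le_max lexx.
have -> : h n = t%:C * u n by rewrite hu ellpZE.
by rewrite normcM normc_real ger0_norm // ler_wpM2l // le_max lexx orbT.
Qed.

(** The partial sums converge absolutely on the unit ball, so there the limit
    along any free ultrafilter is the sum of the series; with it, addition and
    norm bounds pass to the sum directly from the partial sums. *)
Definition diag_poly_diff x h : C := glim F (diff_psum x h).
Definition diag_poly x : C := glim F (diag_psum x).

Let diag_psum_bounded x : lp_norm p x <= 1 -> bounded_cfun (diag_psum x).
Proof. by move=> x1; exists 1 => N; exact: diag_psum_le1. Qed.

Let diff_psum_bounded x h : lp_norm p x <= 1 -> bounded_cfun (diff_psum x h).
Proof. by move=> x1; eexists => N; exact: diff_psum_le. Qed.

Lemma diag_poly_le1 x : lp_norm p x <= 1 -> normc (diag_poly x) <= 1.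
Proof.
move=> x1; apply: normc_glim_le; first exact: diag_psum_bounded.
by apply: (@filterE _ F _) => N; exact: diag_psum_le1.
Qed.

Lemma diag_poly_diff_le x h : lp_norm p x <= 1 ->
  normc (diag_poly_diff x h) <= 2 * m.+1%:R * lp_norm p h.
Proof.
move=> x1; apply: normc_glim_le; first exact: diff_psum_bounded.
by apply: (@filterE _ F _) => N; exact: diff_psum_le.
Qed.

Lemma diag_poly_diff_linear x : lp_norm p x <= 1 -> linear (diag_poly_diff x).
Proof.
move=> x1 a h k; rewrite /diag_poly_diff.
transitivity (glim F (fun N => a * diff_psum x h N + diff_psum x k N)).
  congr (glim F _); apply/funext => N; rewrite /diff_psum mulr_sumr -big_split.
  by apply: eq_bigr => n _; rewrite ellpDE ellpZE /=; ring.
rewrite glimD ?glimZ //; [exact: diff_psum_bounded| |exact: diff_psum_bounded].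
exists (normc a * (2 * m.+1%:R * lp_norm p h)) => N.
by rewrite normcM ler_wpM2l ?normc_ge0 // diff_psum_le.
Qed.

(** The constant does not depend on [x] in the unit ball, which gives at once
    differentiability and uniform continuity. *)
Lemma diag_poly_taylor : exists2 K : R, 0 <= K & forall x h,
  lp_norm p x <= 1 -> lp_norm p h <= 1 ->
  normc (diag_poly (x + h) - diag_poly x - diag_poly_diff x h) <= K * lp_norm p h ^+ 2.
Proof.
have [K K0 KP] := rem_psum_le; exists K; first exact: K0.
move=> x h x1 h1.
have rb : bounded_cfun (rem_psum x h) by eexists => N; exact: KP.
have -> : diag_poly (x + h) = diag_poly x + diag_poly_diff x h + glim F (rem_psum x h).
  have pb : bounded_cfun (fun N => diag_psum x N + diff_psum x h N).
    exists (1 + 2 * m.+1%:R * lp_norm p h) => N.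
    by apply: (le_trans (ler_normcD _ _)); rewrite lerD ?diag_psum_le1 ?diff_psum_le.
  rewrite -glimD; [|exact: diag_psum_bounded|exact: diff_psum_bounded].
  rewrite -glimD; [|exact: pb|exact: rb].
  by congr (glim F _); apply/funext => N; exact: diag_psum_add.
rewrite (_ : _ - _ - _ = glim F (rem_psum x h)); last by ring.
apply: normc_glim_le => //.
by apply: (@filterE _ F _) => N; exact: KP.
Qed.

Lemma diag_poly_lipschitz : exists2 K : R, 0 < K & forall x h,
  lp_norm p x <= 1 -> lp_norm p h <= 1 ->
  normc (diag_poly (x + h) - diag_poly x) <= K * lp_norm p h.
Proof.
have [K K0 KP] := diag_poly_taylor.
exists (K + 2 * m.+1%:R) => [|x h x1 h1].
  by rewrite ltr_wpDl // mulr_gt0.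
rewrite -[X in normc X](subrK (diag_poly_diff x h)) (le_trans (ler_normcD _ _)) // mulrDl.
rewrite lerD ?diag_poly_diff_le // (le_trans (KP _ _ x1 h1)) // ler_wpM2l //.
by rewrite expr2 ler_piMl // lp_norm_ge0.
Qed.
End Polynomial.

(** * Diagonal polynomials belong to the algebra *)

Section Differentiability.
Context {K : numFieldType} {V W : normedModType K}.

Lemma linear_lipschitz_continuous (l : {linear V -> W}) (M : K) : 0 <= M ->
  (forall h, `|l h| <= M * `|h|) -> continuous l.
Proof.
move=> M0 lM; apply: bounded_linear_continuous.
apply/linear_boundedP; near=> r => h.
apply: le_trans (lM h) _; rewrite ler_wpM2r //; near: r.
by apply: nbhs_pinfty_ge; exact: ger0_real.
Unshelve. all: by end_near. Qed.

(** [diff] is a choice among the continuous linear maps that approximate [f] to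
    first order, so exhibiting one such map is enough; [M * `|h| ^+ 2] is
    [o(h)]. *)
Lemma differentiable_quadratic_remainder (f : V -> W) (x : V)
    (l : {linear V -> W}) (M : K) : 0 <= M -> continuous l ->
  (forall h, `|h| <= 1 -> `|f (x + h) - f x - l h| <= M * `|h| ^+ 2) ->
  differentiable f x.
Proof.
move=> M0 lc fl.
have fo : forall e, 0 < e -> \forall y \near x,
    `|(f - (fun y => f x + l (y - x))) y| <= e * `|y - x|.
  move=> e e0; have d0 : 0 < e / (M + 1) by rewrite divr_gt0 // ltr_wpDl.
  near=> y.
  rewrite -[X in `|X|]/(f y - (f x + l (y - x))) opprD addrA.
  have := fl (y - x); rewrite subrKC => /(_ _)/le_trans; apply.
    rewrite distrC ltW //; near: y; exact: (cvgr_dist_lt _ _ (@cvg_id _ (nbhs x)) _ ltr01).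
  rewrite expr2 mulrA ler_wpM2r //.
  have : `|x - y| < e / (M + 1).
    near: y; exact: (cvgr_dist_lt _ _ (@cvg_id _ (nbhs x)) _ d0).
  rewrite distrC ltr_pdivlMr ?ltr_wpDl // mulrC => /ltW; apply: le_trans.
  by rewrite ler_wpM2r // lerDl.
apply/diffP.
pose P (df : {linear V -> W}) := continuous df /\ forall x0 : V,
   f x0 = f (lim (nbhs x)) + df (x0 - lim (nbhs x)) +o_(x0 \near nbhs x) (x0 - lim (nbhs x)).
have PP : P (get P).
  apply: getPex; exists l; split=> //; rewrite (lim_id (@norm_hausdorff _ V)).
  have fE := (eqaddoP (nbhs_filter_on x) _ _ _).2 fo.
  by apply: eqaddoEx => y; exact: (congr1 (fun k => k y) fE).
exact: PP.
Unshelve. all: by end_near. Qed.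
End Differentiability.

Section PolynomialInAlgebra.
Context {R : realType} {p : R} {p1 : 1 <= p}.
Local Notation C := (R[i]^o).
Local Notation E := (ellp p p1).
Context (F : set_system nat) {FU : UltraFilter F}.
Context (m : nat) (pm : p <= m.+1%:R) (c : nat -> C) (c1 : forall n, normc (c n) <= 1).

Lemma unit_ball_lp_norm (x : E) : unit_ball E x -> lp_norm p x < 1.
Proof. by rewrite -ltcR -ellp_normE. Qed.

Lemma diag_poly_differentiable (x : E) : lp_norm p x <= 1 ->
  differentiable (diag_poly F m c : E -> C) x.
Proof.
move=> x1; have [K K0 KP] := diag_poly_taylor F m pm c c1 (p1 := p1).
have dl : linear (diag_poly_diff F m c x : E -> C) by exact: diag_poly_diff_linear.
pose lin := GRing.isLinear.Build _ _ _ _ (diag_poly_diff F m c x : E -> C) dl.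
pose L : {linear E -> C} := HB.pack (diag_poly_diff F m c x : E -> C) lin.
apply: (@differentiable_quadratic_remainder _ _ _ _ x L K%:C).
- by rewrite lecR.
- apply: (@linear_lipschitz_continuous _ _ _ L (2 * m.+1%:R)%:C).
    by rewrite lecR mulr_ge0.
  move=> h; rewrite Defs.normrE ellp_normE -rmorphM lecR.
  exact: diag_poly_diff_le.
- move=> h; rewrite ellp_normE lecR => h1.
  rewrite Defs.normrE -rmorphXn -rmorphM lecR.
  exact: KP.
Qed.

Lemma diag_poly_in_Au : (fun x : unit_ball E => diag_poly F m c (val x)) \in Au_pred (V := E).
Proof.
apply/asboolP; split.
  exists (diag_poly F m c : E -> C) => // x /unit_ball_lp_norm/ltW.
  exact: diag_poly_differentiable.
apply/unif_continuous_ballP => e e0.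
have [K K0 KP] := diag_poly_lipschitz F m pm c c1 (p1 := p1).
exists (Num.min 1 (e / K)) => [|x y]; first by rewrite lt_min ltr01 divr_gt0.
rewrite ellp_normE ltcR lt_min => /andP[xy1 xyK].
have y1 := ltW (unit_ball_lp_norm _ (set_valP y)).
have := KP _ _ y1 (ltW xy1); rewrite subrKC => /le_lt_trans; apply.
by rewrite mulrC -ltr_pdivlMr.
Qed.

Definition diag_poly_elt : Au E := MkAu diag_poly_in_Au.

Lemma diag_poly_elt_norm_le1 : `|diag_poly_elt| <= 1.
Proof.
apply: (Au_norm_le (M := 1)) => x; apply: diag_poly_le1 => //.
exact: ltW (unit_ball_lp_norm _ (set_valP x)).
Qed.
End PolynomialInAlgebra.

(** * Characters obtained as limits of evaluations *)

Section Characters.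
Context {R : realType} {p : R} {p1 : 1 <= p}.
Local Notation C := (R[i]^o).
Local Notation E := (ellp p p1).

(** The unit vectors lie on the unit sphere; they are shrunk into the open ball
    by factors that tend to 1. *)
Definition radius n : R := 1 - n.+1%:R^-1.

Lemma radius_ge0 n : 0 <= radius n.
Proof. by rewrite subr_ge0 invf_le1 ?ler1n ?ltr0n. Qed.

Lemma radius_expr_cvg m (eps : R) : 0 < eps ->
  exists N, forall n, (N <= n)%N -> `|radius n ^+ m - 1| <= eps.
Proof.
move=> eps0.
have rc : radius @ \oo --> (1 : R).
  rewrite -[X in _ --> X]subr0; apply: cvgB; first exact: cvg_cst.
  exact: cvg_harmonic.
have rmc : (fun n => radius n ^+ m) @ \oo --> (1 : R).
  rewrite -[X in _ --> X](expr1n _ m).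
  apply: (@cvg_comp _ _ _ radius (fun y : R => y ^+ m) \oo (nbhs (1 : R)) _ rc).
  exact: exprn_continuous.
have [N _ HN] := cvgr_dist_le _ _ rmc _ eps0.
by exists N => n Nn; rewrite distrC; exact: HN.
Qed.

Lemma point_in_ball n : (radius n)%:C *: basis n \in unit_ball E.
Proof.
rewrite inE /unit_ball /= ellp_normE ltcR lp_normZ lp_norm_basis mulr1.
by rewrite normc_real ger0_norm ?radius_ge0 // gtrBl invr_gt0.
Qed.

Definition point_seq n : unit_ball E := SigSub (point_in_ball n).

Section Char.
Context (U : set_system nat) {UU : UltraFilter U}.

Definition limit_char (f : Au E) : C := glim U (fun n => f (point_seq n)).

Lemma Au_bounded_along (f : Au E) : bounded_cfun (fun n => f (point_seq n)).
Proof.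
have /asboolP[_ /unif_continuous_bounded[M fM]] : val f \in Au_pred (V := E) := valP f.
by exists M => n; exact: fM.
Qed.

Lemma limit_char_spectrum : spectrum limit_char.
Proof.
split.
- move=> a f g; rewrite /limit_char.
  transitivity (glim U (fun n => a * f (point_seq n) + g (point_seq n))); first by [].
  rewrite glimD ?glimZ //; try exact: Au_bounded_along.
  have [M fM] := Au_bounded_along f; exists (normc a * M) => n.
  by rewrite normcM ler_wpM2l ?normc_ge0.
- move=> f g; rewrite /limit_char -glimM //; exact: Au_bounded_along.
- move=> /(congr1 (fun k => k 1)); rewrite /limit_char /=.
  rewrite (_ : glim _ _ = 1) => [|]; last exact: glim_cst.
  by move/eqP; rewrite oner_eq0.
Qed.

Context (U_tail : forall N, U [set n | (N <= n)%N]).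

Lemma limit_char_fiber : 1 < p -> fiber 0 limit_char.
Proof.
move=> p_gt1; split=> [|l cl]; first exact: limit_char_spectrum.
rewrite linear0; apply: glim_eq => [|eps eps0]; first exact: Au_bounded_along.
have [N lN] := basis_weakly_null p_gt1 l cl eps eps0.
apply: filterS (U_tail N) => n /lN; rewrite subr0 /= linearZ normcM.
apply: le_trans; rewrite ler_piMl ?normc_ge0 // normc_real ger0_norm ?radius_ge0 //.
by rewrite gerBl invr_ge0.
Qed.

End Char.

End Characters.

(** * Separation of the limit characters *)

Section Separation.
Context {R : realType} {p : R} {p1 : 1 <= p}.
Local Notation C := (R[i]^o).
Local Notation E := (ellp p p1).
Context (F : set_system nat) {FU : UltraFilter F} (F_tail : forall N, F [set n | (N <= n)%N]).
Context (m : nat) (pm : p <= m.+1%:R) (c : nat -> C) (c1 : forall n, normc (c n) <= 1).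

Lemma diag_poly_point n :
  diag_poly F m c ((radius n)%:C *: basis n : E) = c n * ((radius n)%:C ^+ m.+1).
Proof.
rewrite /diag_poly -[RHS](glim_cst F); apply: glim_near.
apply: filterS (F_tail n.+1) => N nN.
rewrite /diag_psum (bigD1 (Ordinal nN)) // big1 => [|k kn].
  by rewrite ellpZE basisE /= eqxx mulr1 addr0.
rewrite ellpZE basisE (_ : (_ == _) = false) ?mulr0 ?expr0n ?mulr0 //.
by apply/negbTE; apply: contra kn => /eqP kn; apply/eqP/val_inj.
Qed.

Lemma limit_char_diag_poly (U : set_system nat) (UU : UltraFilter U) (s : C) :
  (forall N, U [set n | (N <= n)%N]) -> U [set n | c n = s] ->
  limit_char U (diag_poly_elt (p1 := p1) F m pm c c1) = s.
Proof.
move=> U_tail Us; apply: glim_eq => [|eps eps0]; first exact: Au_bounded_along.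
have [N HN] := radius_expr_cvg (R := R) m.+1 eps eps0.
apply: filterS2 Us (U_tail N) => n /= cs Nn.
rewrite diag_poly_point cs -[X in _ - X]mulr1 -mulrBr normcM.
apply: le_trans (HN n Nn).
by rewrite -rmorphXn -(rmorph1 (real_complex R)) -rmorphB normc_real ler_piMl // -cs.
Qed.
End Separation.

Section GleasonParts.
Context {R : realType} {p : R} {p1 : 1 <= p}.
Local Notation C := (R[i]^o).
Local Notation E := (ellp p p1).

(** The test function is the diagonal polynomial with coefficients 1 on [B] and
    -1 off [B]: its two limits are 1 and -1. *)
Lemma char_dist_limit_char_ge2 (U V : set_system nat) (B : set nat) :
  UltraFilter U -> UltraFilter V ->
  (forall N, U [set n | (N <= n)%N]) -> (forall N, V [set n | (N <= n)%N]) ->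
  U B -> V (~` B) ->
  (2%:E <= char_dist (limit_char (p1 := p1) U) (limit_char V))%E.
Proof.
move=> UU VU U_tail V_tail UB VB.
have [m pm] : exists m, p <= m.+1%:R.
  by exists (Num.trunc p); apply/ltW/truncnS_gt.
pose c n : C := if `[< B n >] then 1 else -1.
have c1 n : normc (c n) <= 1 by rewrite /c; case: ifP => _; rewrite ?normcN normc1.
have cU : U [set n | c n = 1] by apply: filterS UB => n Bn; rewrite /= /c asboolT.
have cV : V [set n | c n = -1] by apply: filterS VB => n Bn; rewrite /= /c asboolF.
(* Any free ultrafilter may sum the series; [U] is at hand. *)
apply: ereal_sup_ubound; exists (diag_poly_elt (p1 := p1) U m pm c c1).
  exact: diag_poly_elt_norm_le1.
rewrite (limit_char_diag_poly U U_tail m pm c c1 U UU 1) //.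
rewrite (limit_char_diag_poly U U_tail m pm c c1 V VU (-1)) //.
rewrite opprK -[_ + _ : C](rmorphD (real_complex R) 1 1) normc_real ger0_norm //.
Qed.

Lemma char_dist_refl_lt2 (phi : Au E -> C) : (char_dist phi phi < 2%:E)%E.
Proof.
apply: (@le_lt_trans _ _ 0%E); last by rewrite lte_fin.
by apply: ge_ereal_sup => _ [f _ <-]; rewrite subrr normc0.
Qed.

Lemma gleason_part_neq (phi psi : Au E -> C) : spectrum phi ->
  (2%:E <= char_dist psi phi)%E -> gleason_part phi <> gleason_part psi.
Proof.
move=> sphi d2 gp; have : gleason_part phi phi.
  by split=> //; exact: char_dist_refl_lt2.
by rewrite gp => -[_]; rewrite ltNge d2.
Qed.
End GleasonParts.

Theorem theorem3p3 (R : realType) (p : R) (p1 : 1 < p) :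
  exists S : set (Au (ellp p (ltW p1)) -> R[i]^o),
    [/\ S `<=` fiber 0,
        S #= [set: set R]
      & forall phi psi, S phi -> S psi -> phi <> psi ->
          gleason_part phi <> gleason_part psi].
Proof.
have [U UP] := @indep_ultrafilters R.
pose char X : Au (ellp p (ltW p1)) -> R[i]^o := limit_char (U X).
have dist X Y : X <> Y -> (2%:E <= char_dist (char X) (char Y))%E.
  move=> XY; have [UU U_tail UI UC] := UP X; have [VU V_tail VI VC] := UP Y.
  have [r rXY] : exists r, ~ (X r <-> Y r).
    apply/not_existsP => h; apply: XY; apply/funext => r; apply/propext.
    exact: contrapT (h r).
  have [Xr|Xr] := pselect (X r).
    apply: (char_dist_limit_char_ge2 _ _ (indep_set r) UU VU U_tail V_tail).
      exact: UI.
    by apply: VC => Yr; exact: rXY.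
  apply: (char_dist_limit_char_ge2 _ _ (~` indep_set r) UU VU U_tail V_tail).
    exact: UC.
  rewrite setCK; apply: VI; apply: contrapT => Yr; apply: rXY.
  by split.
exists (range char); split.
- by move=> _ [X _ <-]; have [UU U_tail _ _] := UP X; exact: limit_char_fiber.
- apply: inj_card_eq => X Y _ _ XY; apply: contrapT => /dist.
  by rewrite XY leNgt char_dist_refl_lt2.
- move=> _ _ [X _ <-] [Y _ <-] XY; apply: gleason_part_neq.
    by have [UU _ _ _] := UP X; exact: limit_char_spectrum.
  by apply: dist => YX; apply: XY; rewrite YX.
Qed.
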